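(* Let $g_0=dr^2+r^2d\theta^2$ be the standard Euclidean metric on $\mathbb{R}^2$ (in polar coordinates) and define $g=e^{r^2}g_0$. The geodesics for $g$ are solutions to $$\kappa=(x,y)\cdot\nu,$$ and conversely every solution of this equation is a geodesic for $g$.
   Context: Curves are considered as unparametrized $C^2$ regular curves in $\mathbb{R}^2$ (so ''geodesic'' means up to reparametrization). In the equation, $\nu$ is a unit normal of the curve at the point $(x,y)$ and $\kappa\nu$ is its curvature vector, both with respect to the Euclidean metric $g_0$; the equation is independent of the choice of $\nu$. Here $r^2=x^2+y^2$. *)

(* Defs.v *)
From Stdlib Require Import Reals.
From Coquelicot Require Import Coquelicot.
Open Scope R_scope.

Definition plane : Type := (R * R)%type.

Inductive coord : Set := cx | cy.

Definition coord_eqb (i j : coord) : bool :=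
  match i, j with cx, cx | cy, cy => true | _, _ => false end.

Definition comp (i : coord) (p : plane) : R :=
  match i with cx => fst p | cy => snd p end.

Definition sum_coord (f : coord -> R) : R := f cx + f cy.

Definition partial (i : coord) (f : plane -> R) (p : plane) : R :=
  match i with
  | cx => Derive (fun u => f (u, snd p)) (fst p)
  | cy => Derive (fun v => f (fst p, v)) (snd p)
  end.

(** [metric] holds the components [g_ij] in the Cartesian coordinates. *)
Definition metric : Type := coord -> coord -> plane -> R.

Definition metric_det (g : metric) (p : plane) : R :=
  g cx cx p * g cy cy p - g cx cy p * g cy cx p.

(** Components [g^ij] of the inverse matrix (Cramer's rule). *)
Definition metric_inv (g : metric) : metric := fun i j p =>
  match i, j with
  | cx, cx => g cy cy p / metric_det g p
  | cy, cy => g cx cx p / metric_det g p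
  | _, _ => - g i j p / metric_det g p
  end.

(** Levi-Civita connection coefficients [Gamma^k_ij]. *)
Definition christoffel (g : metric) (k i j : coord) (p : plane) : R :=
  / 2 * sum_coord (fun l =>
    metric_inv g k l p *
    (partial i (g j l) p + partial j (g i l) p - partial l (g i j) p)).

Definition euclidean : metric := fun i j _ => if coord_eqb i j then 1 else 0.

Definition conformal (f : plane -> R) (g : metric) : metric :=
  fun i j p => f p * g i j p.

Definition radius2 (p : plane) : R := fst p ^ 2 + snd p ^ 2.

Definition g_exp : metric := conformal (fun p => exp (radius2 p)) euclidean.

Definition dot (u v : plane) : R := fst u * fst v + snd u * snd v.

Definition enorm (v : plane) : R := sqrt (dot v v).

(** Intervals are open; unbounded ones are allowed, so closed curves are covered
    by their periodic parametrizations over [(m_infty, p_infty)]. *)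
Definition in_itv (a b : Rbar) (t : R) : Prop := Rbar_lt a t /\ Rbar_lt t b.

Definition C2_on (a b : Rbar) (f : R -> R) : Prop :=
  forall t, in_itv a b t ->
    ex_derive f t /\ ex_derive (Derive f) t /\ continuous (Derive_n f 2) t.

Definition velocity (c : R -> plane) (t : R) : plane :=
  (Derive (fun s => fst (c s)) t, Derive (fun s => snd (c s)) t).

Definition C2_curve (a b : Rbar) (c : R -> plane) : Prop :=
  forall i : coord, C2_on a b (fun t => comp i (c t)).

Definition regular_C2_curve (a b : Rbar) (c : R -> plane) : Prop :=
  Rbar_lt a b /\ C2_curve a b c /\
  forall t, in_itv a b t -> velocity c t <> (0, 0).

(** Affinely parametrized geodesics: the covariant derivative of the velocity
    along the curve vanishes. *)
Definition param_geodesic (g : metric) (a b : Rbar) (c : R -> plane) : Prop :=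
  C2_curve a b c /\
  forall t, in_itv a b t -> forall k : coord,
    Derive_n (fun s => comp k (c s)) 2 t +
    sum_coord (fun i => sum_coord (fun j =>
      christoffel g k i j (c t) *
      comp i (velocity c t) * comp j (velocity c t))) = 0.

(** [phi] is a C^2 diffeomorphism from [(a', b')] onto [(a, b)]. *)
Definition C2_diffeo (a' b' a b : Rbar) (phi : R -> R) : Prop :=
  C2_on a' b' phi /\
  (forall s, in_itv a' b' s -> in_itv a b (phi s)) /\
  exists psi : R -> R,
    C2_on a b psi /\
    (forall t, in_itv a b t -> in_itv a' b' (psi t)) /\
    (forall s, in_itv a' b' s -> psi (phi s) = s) /\
    (forall t, in_itv a b t -> phi (psi t) = t).

(** Geodesic as an unparametrized curve. *)
Definition geodesic (g : metric) (a b : Rbar) (c : R -> plane) : Prop :=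
  exists (a' b' : Rbar) (phi : R -> R),
    C2_diffeo a' b' a b phi /\
    param_geodesic g a' b' (fun s => c (phi s)).

Definition unit_tangent (c : R -> plane) (t : R) : plane :=
  scal (/ enorm (velocity c t)) (velocity c t).

(** [dT/ds], with [s] the Euclidean arc length, [ds/dt = |c'(t)|]. *)
Definition curvature_vector (c : R -> plane) (t : R) : plane :=
  scal (/ enorm (velocity c t)) (velocity (unit_tangent c) t).

Definition unit_normal (c : R -> plane) (t : R) (nu : plane) : Prop :=
  enorm nu = 1 /\ dot (velocity c t) nu = 0.

Definition solves_curvature_eq (a b : Rbar) (c : R -> plane) : Prop :=
  forall t, in_itv a b t ->
  forall nu : plane, unit_normal c t nu ->
  exists kappa : R,
    curvature_vector c t = scal kappa nu /\ kappa = dot (c t) nu.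

Definition polar (q : plane) : plane := (fst q * cos (snd q), fst q * sin (snd q)).

Definition pullback (F : plane -> plane) (g : metric) : metric := fun i j q =>
  sum_coord (fun k => sum_coord (fun l =>
    g k l (F q) *
    partial i (fun p => comp k (F p)) q * partial j (fun p => comp l (F p)) q)).

(** [dx^2 + dy^2] is [dr^2 + r^2 dtheta^2] in the polar coordinates [(r, theta)],
    and [radius2] is [r^2]. *)
Lemma euclidean_polar (r theta : R) :
  pullback polar euclidean cx cx (r, theta) = 1 /\
  pullback polar euclidean cx cy (r, theta) = 0 /\
  pullback polar euclidean cy cx (r, theta) = 0 /\
  pullback polar euclidean cy cy (r, theta) = r ^ 2 /\
  radius2 (polar (r, theta)) = r ^ 2.
Proof.
  pose proof (sin2_cos2 theta) as H; unfold Rsqr in H.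
  assert (Hc : cos theta * cos theta = 1 - sin theta * sin theta) by
    (rewrite <- H; ring).
  assert (D1 : Derive (fun u => u * cos theta) r = cos theta)
    by (apply is_derive_unique; auto_derive; [easy | ring]).
  assert (D2 : Derive (fun u => u * sin theta) r = sin theta)
    by (apply is_derive_unique; auto_derive; [easy | ring]).
  assert (D3 : Derive (fun v => r * cos v) theta = - r * sin theta)
    by (apply is_derive_unique; auto_derive; [easy | ring]).
  assert (D4 : Derive (fun v => r * sin v) theta = r * cos theta)
    by (apply is_derive_unique; auto_derive; [easy | ring]).
  unfold pullback, sum_coord, euclidean, radius2, polar, partial; simpl.
  rewrite D1, D2, D3, D4.
  repeat split; ring [Hc].
Qed.

(* Main.v *)
(** Taking the cross product of the geodesic equation of [g] with the velocity
    removes the tangential part, and with it every trace of the parametrization: what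
    remains is [kappa = (x, y) . nu]. Conversely, along a solution the covariant
    derivative of the velocity is [lambda c'], with [lambda] the logarithmic derivative
    of the [g]-speed [h = |c'| exp (r ^ 2 / 2)], so the reparametrization inverse to
    the [g]-arc length [t |-> int h] makes the curve an affine geodesic. *)

Require Import Defs.
From Stdlib Require Import Reals Ranalysis5 Lra ClassicalEpsilon.
From Coquelicot Require Import Coquelicot.
Open Scope R_scope.

(** * Open intervals and calculus of C^2 functions on them *)

Lemma locally_in_itv (a b : Rbar) (t : R) :
  in_itv a b t -> locally t (in_itv a b).
Proof.
  intros [Ha Hb].
  apply filter_and; [exact (open_Rbar_gt' t a Ha) | exact (open_Rbar_lt' t b Hb)].
Qed.

Lemma in_itv_between (a b : Rbar) (u v t : R) :
  in_itv a b u -> in_itv a b v -> u <= t <= v -> in_itv a b t.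
Proof.
  intros [Hu _] [_ Hv] [H1 H2]; split.
  - apply Rbar_lt_le_trans with u; [exact Hu | exact H1].
  - apply Rbar_le_lt_trans with v; [exact H2 | exact Hv].
Qed.

Lemma in_itv_inhabited (a b : Rbar) : Rbar_lt a b -> exists t, in_itv a b t.
Proof.
  unfold in_itv; destruct a as [a| |], b as [b| |]; simpl; intros H; try easy.
  - exists ((a + b) / 2); lra.
  - exists (a + 1); split; [lra | easy].
  - exists (b - 1); split; [easy | lra].
  - now exists 0.
Qed.

Lemma C2_on_elim (a b : Rbar) (f : R -> R) (t : R) :
  C2_on a b f -> in_itv a b t ->
  is_derive f t (Derive f t) /\
  is_derive (Derive f) t (Derive_n f 2 t) /\
  continuous (Derive_n f 2) t.
Proof.
  intros Hf Ht; destruct (Hf t Ht) as (H1 & H2 & H3).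
  split; [now apply Derive_correct | split; [|easy]].
  now apply (Derive_correct (Derive f)).
Qed.

(** Lets explicit candidates [f1] and [f2] stand for the derivatives. Openness of the interval makes
    [Derive f] agree with [f1] near each point, not just at it, so differentiability and continuity
    transfer. *)
Lemma C2_on_intro (a b : Rbar) (f f1 f2 : R -> R) :
  (forall t, in_itv a b t ->
    is_derive f t (f1 t) /\ is_derive f1 t (f2 t) /\ continuous f2 t) ->
  C2_on a b f /\
  (forall t, in_itv a b t -> Derive f t = f1 t /\ Derive_n f 2 t = f2 t).
Proof.
  intros H.
  assert (E1 : forall t, in_itv a b t -> Derive f t = f1 t)
    by (intros t Ht; apply is_derive_unique, H, Ht).
  assert (D2 : forall t, in_itv a b t -> is_derive (Derive f) t (f2 t)).
  { intros t Ht; apply is_derive_ext_loc with f1; [|apply H, Ht].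
    apply filter_imp with (2 := locally_in_itv _ _ _ Ht).
    intros s Hs; now rewrite E1. }
  assert (E2 : forall t, in_itv a b t -> Derive_n f 2 t = f2 t)
    by (intros t Ht; apply is_derive_unique, D2, Ht).
  split; [|now split; [apply E1 | apply E2]].
  intros t Ht; repeat split.
  - exists (f1 t); apply H, Ht.
  - exists (f2 t); apply D2, Ht.
  - apply continuous_ext_loc with f2; [|apply H, Ht].
    apply filter_imp with (2 := locally_in_itv _ _ _ Ht).
    intros s Hs; now rewrite E2.
Qed.

(** The chain rule applied twice; the two formulas are what a change of parameter does to velocity
    and acceleration. *)
Lemma C2_on_comp (a' b' a b : Rbar) (f phi : R -> R) :
  C2_on a b f -> C2_on a' b' phi ->
  (forall s, in_itv a' b' s -> in_itv a b (phi s)) ->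
  C2_on a' b' (fun s => f (phi s)) /\
  forall s, in_itv a' b' s ->
    Derive (fun s => f (phi s)) s = Derive phi s * Derive f (phi s) /\
    Derive_n (fun s => f (phi s)) 2 s =
      Derive_n phi 2 s * Derive f (phi s) + Derive phi s ^ 2 * Derive_n f 2 (phi s).
Proof.
  intros Hf Hphi Hin.
  apply C2_on_intro; intros s Hs.
  destruct (C2_on_elim _ _ _ _ Hphi Hs) as (P1 & P2 & P3).
  destruct (C2_on_elim _ _ _ _ Hf (Hin s Hs)) as (F1 & F2 & F3).
  assert (Cphi : continuous phi s)
    by (apply (ex_derive_continuous phi); now exists (Derive phi s)).
  assert (Cf' : continuous (Derive f) (phi s))
    by (apply (ex_derive_continuous (Derive f)); now exists (Derive_n f 2 (phi s))).
  split; [|split].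
  - exact (is_derive_comp f phi s _ _ F1 P1).
  - replace (_ + _) with
      (plus (mult (Derive_n phi 2 s) (Derive f (phi s)))
        (mult (Derive phi s) (scal (Derive phi s) (Derive_n f 2 (phi s)))))
      by (unfold plus, mult, scal; simpl; unfold mult; simpl; ring).
    apply (is_derive_mult (Derive phi) (fun s => Derive f (phi s))).
    + exact P2.
    + exact (is_derive_comp (Derive f) phi s _ _ F2 P1).
    + intros; apply Rmult_comm.
  - apply (continuous_plus (fun s => Derive_n phi 2 s * Derive f (phi s))
      (fun s => Derive phi s ^ 2 * Derive_n f 2 (phi s))).
    + apply (continuous_mult (Derive_n phi 2) (fun s => Derive f (phi s))); [easy|].
      now apply continuous_comp.
    + apply (continuous_mult (fun s => Derive phi s ^ 2) (fun s => Derive_n f 2 (phi s))).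
      * apply (ex_derive_continuous (fun s => Derive phi s ^ 2)).
        auto_derive; now exists (Derive_n phi 2 s).
      * now apply continuous_comp.
Qed.

(** Differentiating [psi (phi s) = s], which holds on a neighbourhood of [s], gives
    [phi' * psi' = 1]. *)
Lemma C2_diffeo_Derive_neq_0 (a' b' a b : Rbar) (phi : R -> R) (s : R) :
  C2_diffeo a' b' a b phi -> in_itv a' b' s -> Derive phi s <> 0.
Proof.
  intros (Hphi & Hin & psi & Hpsi & _ & Hid & _) Hs H0.
  destruct (C2_on_elim _ _ _ _ Hphi Hs) as (P1 & _ & _).
  destruct (C2_on_elim _ _ _ _ Hpsi (Hin s Hs)) as (Q1 & _ & _).
  assert (H := is_derive_comp psi phi s _ _ Q1 P1).
  assert (H1 : is_derive (fun s => psi (phi s)) s 1).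
  { apply is_derive_ext_loc with (fun s => s); [|apply (is_derive_id s)].
    apply filter_imp with (2 := locally_in_itv _ _ _ Hs).
    intros u Hu; now rewrite Hid. }
  apply is_derive_unique in H; apply is_derive_unique in H1.
  rewrite H1, H0 in H; unfold scal in H; simpl in H; unfold mult in H; simpl in H.
  lra.
Qed.

(** * Inverses of increasing functions on open intervals *)

Lemma in_itv_neighbours (a b : Rbar) (t eps : R) : 0 < eps -> in_itv a b t ->
  exists u v, in_itv a b u /\ in_itv a b v /\ t - eps < u < t /\ t < v < t + eps.
Proof.
  intros He Ht; destruct (locally_in_itv _ _ _ Ht) as [d Hd].
  set (m := Rmin d eps / 2).
  assert (Hm : 0 < m < d /\ m < eps).
  { pose proof (cond_pos d); pose proof (Rmin_l d eps); pose proof (Rmin_r d eps).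
    assert (0 < Rmin d eps) by now apply Rmin_glb_lt.
    unfold m; lra. }
  exists (t - m), (t + m); repeat apply conj; try lra.
  all: apply Hd; unfold ball; simpl; unfold AbsRing_ball, abs, minus, plus, opp; simpl.
  all: apply Rabs_def1; lra.
Qed.

Lemma pos_derive_increasing (a b : Rbar) (f h : R -> R) :
  (forall t, in_itv a b t -> is_derive f t (h t)) ->
  (forall t, in_itv a b t -> 0 < h t) ->
  forall u v, in_itv a b u -> in_itv a b v -> u < v -> f u < f v.
Proof.
  intros Df hpos u v Hu Hv Huv.
  assert (Hin : forall x, Rmin u v <= x <= Rmax u v -> in_itv a b x).
  { intros x; rewrite Rmin_left, Rmax_right by lra.
    now apply in_itv_between. }
  destruct (MVT_gen f u v h) as (x & Hx & E).
  - intros x Hx; apply Df, Hin; lra.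
  - intros x Hx; apply continuity_pt_filterlim, (ex_derive_continuous f).
    exists (h x); now apply Df, Hin.
  - assert (0 < h x * (v - u)) by (apply Rmult_lt_0_compat; [now apply hpos, Hin | lra]).
    lra.
Qed.

Lemma increasing_reflects_lt (a b : Rbar) (f : R -> R) :
  (forall u v, in_itv a b u -> in_itv a b v -> u < v -> f u < f v) ->
  forall u v, in_itv a b u -> in_itv a b v -> f u < f v -> u < v.
Proof.
  intros Hf u v Hu Hv H; destruct (Rtotal_order u v) as [L|[->|L]]; [easy|lra|].
  apply Hf in L; auto; lra.
Qed.

(** The endpoints are the infimum and supremum of the image in [Rbar]. The intermediate value
    theorem fills everything between them, and strict monotonicity on an open interval keeps them
    from being attained. *)
Lemma increasing_image_itv (a b : Rbar) (f : R -> R) :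
  (forall t, in_itv a b t -> continuous f t) ->
  (forall u v, in_itv a b u -> in_itv a b v -> u < v -> f u < f v) ->
  exists a' b', forall s,
    in_itv a' b' s <-> exists t, in_itv a b t /\ f t = s.
Proof.
  intros Cf Hf.
  set (image := fun s => exists t, in_itv a b t /\ f t = s).
  exists (Glb_Rbar image), (Lub_Rbar image); intros s.
  destruct (Glb_Rbar_correct image) as [G1 G2].
  destruct (Lub_Rbar_correct image) as [L1 L2].
  split.
  - intros [Hl Hr].
    (* Otherwise [s] would be a lower bound of the image larger than its infimum; the bound from
       above is symmetric. *)
    assert (exists u, in_itv a b u /\ f u < s) as (u & Hu & Hus).
    { apply NNPP; intros N.
      apply (Rbar_lt_not_le _ _ Hl), G2; intros y (t & Ht & <-); simpl.
      apply Rnot_lt_le; intros Hlt; apply N; now exists t. }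
    assert (exists v, in_itv a b v /\ s < f v) as (v & Hv & Hvs).
    { apply NNPP; intros N.
      apply (Rbar_lt_not_le _ _ Hr), L2; intros y (t & Ht & <-); simpl.
      apply Rnot_lt_le; intros Hlt; apply N; now exists t. }
    assert (Huv : u < v) by (apply (increasing_reflects_lt a b f); auto; lra).
    destruct (IVT_interv (fun t => f t - s) u v) as (t & Ht & E); try lra.
    + intros t Ht; apply continuity_pt_minus;
        [|now apply continuity_pt_const; intros ? ?].
      apply continuity_pt_filterlim, Cf, in_itv_between with u v; auto.
    + exists t; split; [now apply in_itv_between with u v | lra].
  - intros (t & Ht & <-).
    (* Values at points on both sides of [t] separate [f t] from the infimum and the supremum; the
       distance [1] is arbitrary. *)
    destruct (in_itv_neighbours a b t 1) as (u & v & Hu & Hv & H1 & H2); [lra | easy |].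
    split.
    + apply Rbar_le_lt_trans with (f u).
      * apply G1; now exists u.
      * apply Hf; auto; lra.
    + apply Rbar_lt_le_trans with (f v).
      * apply Hf; auto; lra.
      * apply L1; now exists v.
Qed.

(** The difference quotient of [g] is the reciprocal of one of [f]: with [m = g (s + k) - g s], the
    quotient [k / m] tends to [l], because continuity of [g] makes [m] small. *)
Lemma is_derive_inverse (f g : R -> R) (s l : R) :
  l <> 0 -> is_derive f (g s) l -> continuous g s ->
  locally s (fun u => f (g u) = u) ->
  is_derive g s (/ l).
Proof.
  intros Hl Hf Hg Hid.
  apply is_derive_Reals; apply is_derive_Reals in Hf.
  assert (Hs : f (g s) = s) by exact (locally_singleton _ _ Hid).
  assert (Hgl : 0 < Rabs l) by now apply Rabs_pos_lt.
  intros eps Heps.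
  (* The first bound forces [|q| > |l| / 2] for [q = k / m]; the second then puts [|q - l|] below
     [eps * |q| * |l|], which is the estimate for [|1 / q - 1 / l|]. *)
  set (e := Rmin (Rabs l / 2) (eps * (Rabs l * Rabs l) / 4)).
  assert (He : 0 < e).
  { apply Rmin_glb_lt; [lra|].
    assert (0 < eps * (Rabs l * Rabs l)) by (repeat apply Rmult_lt_0_compat; lra). lra. }
  destruct (Hf e He) as [d Hd].
  assert (HH : locally s (fun u => f (g u) = u /\ ball (g s) d (g u))).
  { apply filter_and; [exact Hid|]. apply Hg. now exists d. }
  destruct HH as [d' Hd']; exists d'; intros k Hk Hkd.
  destruct (Hd' (s + k)) as [E B].
  { unfold ball; simpl; unfold AbsRing_ball, abs, minus, plus, opp; simpl.
    now replace (s + k + - s) with k by ring. }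
  set (m := g (s + k) - g s).
  assert (Hm : m <> 0).
  { intros H0; apply Hk. unfold m in H0.
    replace (g (s + k)) with (g s) in E by lra. lra. }
  assert (Hmd : Rabs m < d) by exact B.
  specialize (Hd m Hm Hmd).
  replace (g s + m) with (g (s + k)) in Hd by (unfold m; ring).
  rewrite E, Hs in Hd.
  replace (s + k - s) with k in Hd by ring.
  fold m.
  set (q := k / m) in *.
  assert (Hq : Rabs l / 2 < Rabs q).
  { pose proof (Rmin_l (Rabs l / 2) (eps * (Rabs l * Rabs l) / 4)) as He1; fold e in He1.
    pose proof (Rabs_triang_inv l q). rewrite Rabs_minus_sym in Hd. lra. }
  assert (Hq0 : q <> 0) by (intros H0; rewrite H0, Rabs_R0 in Hq; lra).
  replace (m / k - / l) with (- ((q - l) / (q * l))) by (unfold q; field; auto).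
  rewrite Rabs_Ropp; unfold Rdiv; rewrite Rabs_mult, Rabs_inv, Rabs_mult.
  assert (Hql : 0 < Rabs q * Rabs l) by (apply Rmult_lt_0_compat; lra).
  apply Rmult_lt_reg_r with (Rabs q * Rabs l); [easy|].
  rewrite Rmult_assoc, Rinv_l, Rmult_1_r by lra.
  apply Rlt_le_trans with e; [easy|].
  apply Rle_trans with (1 := Rmin_r _ _).
  assert (0 <= eps * Rabs l * (Rabs q - Rabs l / 2))
    by (repeat apply Rmult_le_pos; lra).
  assert (0 < eps * (Rabs l * Rabs l)) by (repeat apply Rmult_lt_0_compat; lra).
  lra.
Qed.

(** Applied to an arc length function [psi] with speed [h]: its inverse [phi] satisfies
    [phi' = 1 / h(phi)], and differentiating this once more gives the second derivative. *)
Lemma C2_diffeo_inverse (a b : Rbar) (psi h h' : R -> R) :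
  (forall t, in_itv a b t -> is_derive psi t (h t)) ->
  (forall t, in_itv a b t -> is_derive h t (h' t)) ->
  (forall t, in_itv a b t -> continuous h' t) ->
  (forall t, in_itv a b t -> 0 < h t) ->
  exists (a' b' : Rbar) (phi : R -> R), C2_diffeo a' b' a b phi /\
    forall s, in_itv a' b' s ->
      Derive phi s = / h (phi s) /\
      Derive_n phi 2 s = - h' (phi s) / h (phi s) ^ 3.
Proof.
  intros Dpsi Dh Ch' hpos.
  assert (Hinc := pos_derive_increasing a b psi h Dpsi hpos).
  destruct (increasing_image_itv a b psi) as (a' & b' & Him); [|exact Hinc|].
  { intros t Ht; apply (ex_derive_continuous psi); exists (h t); auto. }
  (* The preimage under [psi] is picked by choice; outside the image the value is arbitrary and
     never inspected. *)
  set (phi := fun s => epsilon (inhabits 0) (fun t => in_itv a b t /\ psi t = s)).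
  assert (Hphi : forall s, in_itv a' b' s -> in_itv a b (phi s) /\ psi (phi s) = s).
  { intros s Hs; apply epsilon_spec, Him, Hs. }
  assert (Hid : forall t, in_itv a b t -> phi (psi t) = t).
  { intros t Ht.
    destruct (Hphi (psi t)) as [H1 H2]; [apply Him; now exists t|].
    destruct (Rtotal_order (phi (psi t)) t) as [L|[L|L]]; [|easy|];
      apply Hinc in L; auto; lra. }
  assert (Cphi : forall s, in_itv a' b' s -> continuous phi s).
  { intros s Hs; apply filterlim_locally; intros eps.
    destruct (Hphi s Hs) as [H1 H2].
    (* Continuity of the inverse: when [r] lies between [psi u] and [psi v], monotonicity traps
       [phi r] between [u] and [v], hence within [eps] of [phi s]. *)
    destruct (in_itv_neighbours a b (phi s) eps) as (u & v & Hu & Hv & Hus & Hvs);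
      [apply cond_pos | easy |].
    assert (in_itv (psi u) (psi v) s) as Hs'.
    { rewrite <- H2; split; simpl; apply Hinc; auto; lra. }
    generalize (filter_and _ _ (locally_in_itv _ _ _ Hs) (locally_in_itv _ _ _ Hs')).
    apply filter_imp; intros r [Hr [Hru Hrv]]; simpl in Hru, Hrv.
    destruct (Hphi r Hr) as [K1 K2].
    assert (u < phi r) by (apply (increasing_reflects_lt a b psi); auto; lra).
    assert (phi r < v) by (apply (increasing_reflects_lt a b psi); auto; lra).
    unfold ball; simpl; unfold AbsRing_ball, abs, minus, plus, opp; simpl.
    apply Rabs_def1; lra. }
  assert (Dphi : forall s, in_itv a' b' s -> is_derive phi s (/ h (phi s))).
  { intros s Hs; destruct (Hphi s Hs) as [H1 H2].
    apply is_derive_inverse with psi; auto.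
    - specialize (hpos _ H1); lra.
    - apply filter_imp with (2 := locally_in_itv _ _ _ Hs).
      intros r Hr; now apply Hphi. }
  destruct (C2_on_intro a' b' phi (fun s => / h (phi s))
    (fun s => - h' (phi s) / h (phi s) ^ 3)) as [HC HD].
  { intros s Hs; destruct (Hphi s Hs) as [H1 H2].
    assert (Hh : h (phi s) <> 0) by (specialize (hpos _ H1); lra).
    split; [now apply Dphi | split].
    - replace (- h' (phi s) / h (phi s) ^ 3)
        with (- (/ h (phi s) * h' (phi s)) / h (phi s) ^ 2) by (field; auto).
      apply (is_derive_inv (fun s => h (phi s))); [|easy].
      exact (is_derive_comp h phi s _ _ (Dh _ H1) (Dphi s Hs)).
    - apply (continuous_comp phi (fun t => - h' t / h t ^ 3)); [now apply Cphi|].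
      apply (continuous_mult (fun t => - h' t) (fun t => / h t ^ 3)).
      + apply (continuous_opp h'); auto.
      + apply (ex_derive_continuous (fun t => / h t ^ 3)).
        auto_derive; split; [exists (h' (phi s)); now apply Dh | split; [|easy]].
        repeat apply Rmult_integral_contrapositive_currified; auto; lra. }
  exists a', b', phi; split; [|exact HD].
  split; [exact HC | split; [intros s Hs; now apply Hphi |]].
  exists psi; split; [|split; [|split]].
  - apply (C2_on_intro a b psi h h'); auto.
  - intros t Ht; apply Him; now exists t.
  - intros s Hs; now apply Hphi.
  - exact Hid.
Qed.

(** * Connection coefficients of the conformal metric, and Euclidean curvature in coordinates *)

(** The general formula for a metric [e^(2w) g_0], namely [delta_ki d_j w + delta_kj d_i w -
    delta_ij d_k w], with [w = r^2 / 2], whose gradient is the position vector. The exponential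
    cancels against the inverse metric. *)
Lemma christoffel_g_exp (k i j : coord) (p : plane) :
  christoffel g_exp k i j p =
    (if coord_eqb k i then Defs.comp j p else 0) +
    (if coord_eqb k j then Defs.comp i p else 0) -
    (if coord_eqb i j then Defs.comp k p else 0).
Proof.
  assert (Dg : forall l i j : coord, partial l (g_exp i j) p =
    if coord_eqb i j then 2 * Defs.comp l p * exp (radius2 p) else 0).
  { intros l i' j'; destruct p as [x y].
    destruct l; unfold partial, g_exp, conformal, euclidean, radius2; simpl;
      destruct (coord_eqb i' j'); apply is_derive_unique; auto_derive; auto; ring. }
  assert (He : exp (radius2 p) <> 0) by apply Rgt_not_eq, exp_pos.
  unfold christoffel, sum_coord; rewrite !Dg.
  unfold metric_inv, metric_det, g_exp, conformal, euclidean.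
  destruct k, i, j; simpl; field; auto.
Qed.

(** The equation at one point, for the position [(x, y)] and the first and second
    derivatives [(X, Y)] and [(A, B)]; it is the equation [kappa = (x, y) . nu]
    multiplied by [|(X, Y)| ^ 3], with [nu = (-Y, X) / |(X, Y)|]. *)
Definition curvature_rel (x y X Y A B : R) : Prop :=
  X * B - Y * A = (X ^ 2 + Y ^ 2) * (y * X - x * Y).

Lemma sum_sqr_pos (X Y : R) : (X, Y) <> (0, 0) -> 0 < X ^ 2 + Y ^ 2.
Proof.
  intros H.
  destruct (Req_dec X 0) as [->|HX].
  - assert (HY : Y <> 0) by (intros ->; now apply H).
    pose proof (pow2_gt_0 Y HY); lra.
  - pose proof (pow2_gt_0 X HX); pose proof (pow2_ge_0 Y); lra.
Qed.

Lemma enorm_pair (X Y : R) : enorm (X, Y) = sqrt (X ^ 2 + Y ^ 2).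
Proof. unfold enorm, dot; f_equal; simpl; ring. Qed.

Lemma scal_pair (k u v : R) : scal k ((u, v) : plane) = (k * u, k * v).
Proof. reflexivity. Qed.

(** The quotient rule leaves [A |V|^2 - X (X A + Y B)] over [|V|^3], whose numerator is
    [- Y (X B - Y A)]. One component suffices: exchanging [X] and [Y] gives the other. *)
Lemma is_derive_normalized (X Y : R -> R) (t A B : R) :
  is_derive X t A -> is_derive Y t B -> 0 < X t ^ 2 + Y t ^ 2 ->
  is_derive (fun s => / sqrt (X s ^ 2 + Y s ^ 2) * X s) t
    (- Y t * (X t * B - Y t * A) / sqrt (X t ^ 2 + Y t ^ 2) ^ 3).
Proof.
  intros DX DY HN.
  assert (Hs : 0 < sqrt (X t ^ 2 + Y t ^ 2)) by now apply sqrt_lt_R0.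
  assert (Hss : sqrt (X t ^ 2 + Y t ^ 2) ^ 2 = X t ^ 2 + Y t ^ 2)
    by (apply pow2_sqrt; lra).
  auto_derive.
  - split; [now exists A | split; [now exists B |]].
    simpl in *; repeat split; [lra | lra | now exists A].
  - replace (Derive _ t) with A by (symmetry; now apply is_derive_unique).
    replace (Derive _ t) with B by (symmetry; now apply is_derive_unique).
    simpl in *.
    set (S := sqrt _) in *.
    field_simplify_eq; [|lra].
    replace (S ^ 2) with (X t ^ 2 + Y t ^ 2) by (simpl; lra).
    ring.
Qed.

(** This is the signed curvature [(X B - Y A) / |V|^3] times the unit normal [(-Y, X) / |V|];
    collecting the powers of [|V|] removes the square roots. *)
Lemma curvature_vector_eq (c : R -> plane) (t A B : R) :
  let X := Derive (fun s => fst (c s)) t in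
  let Y := Derive (fun s => snd (c s)) t in
  velocity c t <> (0, 0) ->
  is_derive (Derive (fun s => fst (c s))) t A ->
  is_derive (Derive (fun s => snd (c s))) t B ->
  curvature_vector c t =
    scal ((X * B - Y * A) / (X ^ 2 + Y ^ 2) ^ 2) (- Y, X).
Proof.
  intros X Y Hv DX DY.
  assert (HN : 0 < X ^ 2 + Y ^ 2) by now apply sum_sqr_pos.
  assert (Hs : 0 < sqrt (X ^ 2 + Y ^ 2)) by now apply sqrt_lt_R0.
  assert (Hss : (X ^ 2 + Y ^ 2) ^ 2 = sqrt (X ^ 2 + Y ^ 2) ^ 4).
  { replace (sqrt (X ^ 2 + Y ^ 2) ^ 4) with ((sqrt (X ^ 2 + Y ^ 2) ^ 2) ^ 2) by ring.
    rewrite pow2_sqrt; lra. }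
  assert (T1 : Derive (fun s => fst (unit_tangent c s)) t =
    - Y * (X * B - Y * A) / sqrt (X ^ 2 + Y ^ 2) ^ 3).
  { apply is_derive_unique.
    apply is_derive_ext with (2 := is_derive_normalized _ _ _ _ _ DX DY HN).
    intros s; unfold unit_tangent, velocity; now rewrite enorm_pair. }
  assert (T2 : Derive (fun s => snd (unit_tangent c s)) t =
    X * (X * B - Y * A) / sqrt (X ^ 2 + Y ^ 2) ^ 3).
  { apply is_derive_unique.
    (* Rewritten into the shape of the first component with [X] and [Y] exchanged, which flips the
       sign of the cross product. *)
    replace (X * _ / _) with (- X * (Y * A - X * B) / sqrt (Y ^ 2 + X ^ 2) ^ 3)
      by (rewrite (Rplus_comm (Y ^ 2)); field; lra).
    rewrite Rplus_comm in HN.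
    apply is_derive_ext with (2 := is_derive_normalized _ _ _ _ _ DY DX HN).
    intros s; unfold unit_tangent, velocity.
    now rewrite enorm_pair, Rplus_comm. }
  unfold curvature_vector; unfold velocity at 2; rewrite T1, T2.
  unfold velocity; rewrite enorm_pair; fold X Y.
  rewrite Hss; clear -Hs; set (S := sqrt (X ^ 2 + Y ^ 2)) in *.
  rewrite !scal_pair; f_equal; field; lra.
Qed.

(** One direction tests the equation on a single normal. The other writes every unit normal as
    [m (-Y, X)]; both sides of the equation are then compared through [m^2] only, so the choice of
    normal is immaterial. *)
Lemma curvature_eq_iff_rel (c : R -> plane) (t A B : R) :
  velocity c t <> (0, 0) ->
  is_derive (Derive (fun s => fst (c s))) t A ->
  is_derive (Derive (fun s => snd (c s))) t B ->
  (forall nu : plane, unit_normal c t nu ->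
     exists kappa, curvature_vector c t = scal kappa nu /\ kappa = dot (c t) nu) <->
  curvature_rel (fst (c t)) (snd (c t)) (fst (velocity c t)) (snd (velocity c t)) A B.
Proof.
  intros Hv DX DY.
  rewrite (curvature_vector_eq c t A B Hv DX DY).
  unfold unit_normal, curvature_rel, velocity in *; simpl fst; simpl snd.
  set (X := Derive (fun s => fst (c s)) t) in *.
  set (Y := Derive (fun s => snd (c s)) t) in *.
  clearbody X Y; clear DX DY.
  destruct (c t) as [x y]; simpl fst; simpl snd.
  assert (HN : 0 < X ^ 2 + Y ^ 2) by now apply sum_sqr_pos.
  set (N := X ^ 2 + Y ^ 2) in *.
  split.
  - intros H.
    assert (Hs : 0 < sqrt N) by now apply sqrt_lt_R0.
    assert (Hss : sqrt N ^ 2 = N) by (apply pow2_sqrt; lra).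
    set (S := sqrt N) in *.
    (* The velocity rotated by a right angle and normalized. *)
    destruct (H (- Y / S, X / S)) as (kappa & E & Ek).
    { split.
      - rewrite enorm_pair.
        replace ((- Y / S) ^ 2 + (X / S) ^ 2) with (N / S ^ 2)
          by (unfold N; field; lra).
        rewrite Hss; unfold Rdiv; rewrite Rinv_r by lra; apply sqrt_1.
      - unfold dot; simpl; field; lra. }
    unfold dot in Ek; simpl in Ek.
    rewrite !scal_pair in E.
    assert (E1 := f_equal fst E); assert (E2 := f_equal snd E); cbn [fst snd] in E1, E2.
    set (K := (X * B - Y * A) / N ^ 2) in *.
    assert (EK : X * B - Y * A = K * N ^ 2) by (unfold K; field; lra).
    (* Inner product of the vector equation with [(-Y, X)]. *)
    assert (E3 : K * N = (y * X - x * Y) / S ^ 2 * N).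
    { replace (K * N) with (- Y * (K * - Y) + X * (K * X)) by (unfold N; ring).
      rewrite E1, E2, Ek; unfold N; field; lra. }
    rewrite Hss in E3.
    rewrite EK; replace (K * N ^ 2) with (K * N * N) by ring.
    rewrite E3; field; lra.
  - intros E [n1 n2] [Hn1 Hn2].
    exists (dot (x, y) (n1, n2)); split; [|easy].
    rewrite enorm_pair in Hn1; unfold dot in *; cbn [fst snd] in *.
    assert (Hn : n1 ^ 2 + n2 ^ 2 = 1).
    { apply (f_equal (fun r => r ^ 2)) in Hn1; rewrite pow2_sqrt in Hn1; [lra|].
      pose proof (pow2_ge_0 n1); pose proof (pow2_ge_0 n2); lra. }
    (* The coefficient of the normal along [(-Y, X)]; orthogonality to the velocity leaves no other
       component. *)
    set (m := (X * n2 - Y * n1) / N).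
    assert (M1 : n1 = - m * Y).
    { apply Rmult_eq_reg_r with N; [|lra].
      replace (- m * Y * N) with (- (X * n2 - Y * n1) * Y) by (unfold m; field; lra).
      replace (n1 * N) with (- (X * n2 - Y * n1) * Y + X * (X * n1 + Y * n2))
        by (unfold N; ring).
      rewrite Hn2; ring. }
    assert (M2 : n2 = m * X).
    { apply Rmult_eq_reg_r with N; [|lra].
      replace (m * X * N) with ((X * n2 - Y * n1) * X) by (unfold m; field; lra).
      replace (n2 * N) with ((X * n2 - Y * n1) * X + Y * (X * n1 + Y * n2))
        by (unfold N; ring).
      rewrite Hn2; ring. }
    assert (M3 : m ^ 2 * N = 1) by (rewrite <- Hn, M1, M2; unfold N; ring).
    rewrite E, M1, M2.
    replace (N * (y * X - x * Y) / N ^ 2) with (m ^ 2 * N * (y * X - x * Y) / N)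
      by (rewrite M3; field; lra).
    clear -HN; clearbody m.
    rewrite !scal_pair; f_equal; field; lra.
Qed.

(** * The geodesic equation of the conformal metric under reparametrization *)

Lemma geodesic_term_g_exp (k : coord) (p v : plane) :
  sum_coord (fun i => sum_coord (fun j =>
    christoffel g_exp k i j p * Defs.comp i v * Defs.comp j v)) =
  2 * dot p v * Defs.comp k v - dot v v * Defs.comp k p.
Proof.
  unfold sum_coord; rewrite !christoffel_g_exp.
  unfold dot; destruct k; simpl; ring.
Qed.

(** Here [h] is the length of the velocity in the conformal metric. The factor multiplying [h t] is
    its logarithmic derivative: one term from the Euclidean speed, one from the exponential. *)
Lemma is_derive_conformal_speed (x y X Y : R -> R) (t A B : R) :
  is_derive x t (X t) -> is_derive y t (Y t) ->
  is_derive X t A -> is_derive Y t B -> 0 < X t ^ 2 + Y t ^ 2 ->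
  let h := fun s => sqrt (X s ^ 2 + Y s ^ 2) * exp ((x s ^ 2 + y s ^ 2) / 2) in
  is_derive h t
    (h t * ((X t * A + Y t * B) / (X t ^ 2 + Y t ^ 2) + (x t * X t + y t * Y t))).
Proof.
  intros Dx Dy DX DY HN h; unfold h; clear h.
  assert (Hs : 0 < sqrt (X t ^ 2 + Y t ^ 2)) by now apply sqrt_lt_R0.
  assert (Hss : sqrt (X t ^ 2 + Y t ^ 2) ^ 2 = X t ^ 2 + Y t ^ 2)
    by (apply pow2_sqrt; lra).
  replace ((X t * A + Y t * B) / (X t ^ 2 + Y t ^ 2))
    with ((X t * A + Y t * B) / sqrt (X t ^ 2 + Y t ^ 2) ^ 2) by now rewrite Hss.
  auto_derive.
  - simpl in HN; repeat apply conj; try easy; eexists; eassumption.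
  - replace (Derive (fun s => X s) t) with A by (symmetry; now apply is_derive_unique).
    replace (Derive (fun s => Y s) t) with B by (symmetry; now apply is_derive_unique).
    replace (Derive (fun s => x s) t) with (X t) by (symmetry; now apply is_derive_unique).
    replace (Derive (fun s => y s) t) with (Y t) by (symmetry; now apply is_derive_unique).
    simpl in *; unfold Rdiv at 1.
    set (S := sqrt _) in *; set (e := exp _); field; lra.
Qed.

(** This and the next lemma are phrased with real [+] and [*] so that [apply] can decompose goals
    repeatedly. *)
Lemma continuous_Rplus (f g : R -> R) (t : R) :
  continuous f t -> continuous g t -> continuous (fun s => f s + g s) t.
Proof. exact (continuous_plus f g t). Qed.

Lemma continuous_Rmult (f g : R -> R) (t : R) :
  continuous f t -> continuous g t -> continuous (fun s => f s * g s) t.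
Proof. exact (continuous_mult f g t). Qed.

(** The connection term is quadratic in the velocity, so it scales by [phi'^2] like the acceleration
    part of the chain rule; the change of parameter adds only the tangential term [phi'' c']. *)
Lemma geodesic_reparam_iff (a b a' b' : Rbar) (c : R -> plane) (phi : R -> R) :
  C2_curve a b c -> C2_on a' b' phi ->
  (forall s, in_itv a' b' s -> in_itv a b (phi s)) ->
  param_geodesic g_exp a' b' (fun s => c (phi s)) <->
  forall s, in_itv a' b' s -> forall k : coord,
    Derive_n phi 2 s * Defs.comp k (velocity c (phi s)) +
    Derive phi s ^ 2 *
      (Derive_n (fun t => Defs.comp k (c t)) 2 (phi s) +
       2 * dot (c (phi s)) (velocity c (phi s)) * Defs.comp k (velocity c (phi s)) -
       dot (velocity c (phi s)) (velocity c (phi s)) * Defs.comp k (c (phi s))) = 0.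
Proof.
  intros Hc Hphi Hin.
  assert (HC := fun k => C2_on_comp a' b' a b _ phi (Hc k) Hphi Hin).
  assert (E : forall s, in_itv a' b' s -> forall k,
    Derive_n (fun s => Defs.comp k (c (phi s))) 2 s +
    sum_coord (fun i => sum_coord (fun j =>
      christoffel g_exp k i j (c (phi s)) *
      Defs.comp i (velocity (fun s => c (phi s)) s) *
      Defs.comp j (velocity (fun s => c (phi s)) s))) =
    Derive_n phi 2 s * Defs.comp k (velocity c (phi s)) +
    Derive phi s ^ 2 *
      (Derive_n (fun t => Defs.comp k (c t)) 2 (phi s) +
       2 * dot (c (phi s)) (velocity c (phi s)) * Defs.comp k (velocity c (phi s)) -
       dot (velocity c (phi s)) (velocity c (phi s)) * Defs.comp k (c (phi s)))).
  { intros s Hs k.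
    rewrite geodesic_term_g_exp.
    assert (V : velocity (fun s => c (phi s)) s = scal (Derive phi s) (velocity c (phi s))).
    { unfold velocity; rewrite scal_pair; f_equal.
      - exact (proj1 (proj2 (HC cx) s Hs)).
      - exact (proj1 (proj2 (HC cy) s Hs)). }
    rewrite V.
    assert (D2 := proj2 (proj2 (HC k) s Hs)); cbv beta in D2; rewrite D2.
    replace (Derive (fun t => Defs.comp k (c t)) (phi s))
      with (Defs.comp k (velocity c (phi s))) by now destruct k.
    destruct (velocity c (phi s)) as [X Y]; rewrite scal_pair.
    unfold dot; destruct k; cbn -[Derive_n pow]; ring. }
  split.
  - intros [_ H] s Hs k; rewrite <- E by easy; now apply H.
  - intros H; split; [intros k; apply HC|].
    intros s Hs k; rewrite E by easy; now apply H.
Qed.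

(** * Passage between geodesics and solutions of the curvature equation *)

Theorem proposition2p3 (a b : Rbar) (c : R -> plane)
    (hc : regular_C2_curve a b c) :
  geodesic g_exp a b c <-> solves_curvature_eq a b c.
Proof.
  destruct hc as (Hab & Hc & Hreg).
  set (A := Derive_n (fun t => fst (c t)) 2).
  set (B := Derive_n (fun t => snd (c t)) 2).
  assert (Hrel : solves_curvature_eq a b c <-> forall t, in_itv a b t ->
    curvature_rel (fst (c t)) (snd (c t))
      (fst (velocity c t)) (snd (velocity c t)) (A t) (B t)).
  { assert (H : forall t, in_itv a b t -> _) by (intros t Ht;
      exact (curvature_eq_iff_rel c t (A t) (B t) (Hreg t Ht)
        (proj1 (proj2 (C2_on_elim _ _ _ _ (Hc cx) Ht)))
        (proj1 (proj2 (C2_on_elim _ _ _ _ (Hc cy) Ht))))).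
    split; intros G t Ht; apply (H t Ht), (G t Ht). }
  rewrite Hrel; clear Hrel; split.
  - intros (a' & b' & phi & Hphi & Hgeo) t Ht.
    assert (Hphi' := Hphi).
    destruct Hphi' as (Cphi & Hin & psi & _ & Hpsi & _ & Hid).
    rewrite (geodesic_reparam_iff a b a' b') in Hgeo by easy.
    assert (Hs := Hpsi t Ht).
    assert (Hq := C2_diffeo_Derive_neq_0 _ _ _ _ _ _ Hphi Hs).
    assert (Ex := Hgeo (psi t) Hs cx); assert (Ey := Hgeo (psi t) Hs cy).
    rewrite Hid in Ex, Ey by easy.
    change (Derive_n (fun t => Defs.comp cx (c t)) 2 t) with (A t) in Ex.
    change (Derive_n (fun t => Defs.comp cy (c t)) 2 t) with (B t) in Ey.
    revert Ex Ey Hq; generalize (Derive phi (psi t)) (Derive_n phi 2 (psi t)).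
    destruct (c t) as [x y], (velocity c t) as [X Y].
    unfold dot, curvature_rel; cbn -[pow]; intros q q' Ex Ey Hq.
    (* With [q] and [q'] the two derivatives of the parameter change, [X] times the second equation
       minus [Y] times the first cancels every multiple of the velocity, including the [q'] term,
       and leaves [q^2] times the relation. *)
    apply Rmult_eq_reg_l with (q ^ 2); [|now apply pow_nonzero].
    apply (f_equal (Rmult Y)) in Ex; apply (f_equal (Rmult X)) in Ey.
    lra.
  - intros H.
    set (X := Derive (fun t => fst (c t))) in *.
    set (Y := Derive (fun t => snd (c t))) in *.
    set (N := fun t => X t ^ 2 + Y t ^ 2).
    set (h := fun t => sqrt (N t) * exp (radius2 (c t) / 2)).
    set (lam := fun t => (X t * A t + Y t * B t) / N t +
      (fst (c t) * X t + snd (c t) * Y t)).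
    assert (HN : forall t, in_itv a b t -> 0 < N t)
      by (intros t Ht; now apply sum_sqr_pos, Hreg).
    assert (hpos : forall t, in_itv a b t -> 0 < h t).
    { intros t Ht; apply Rmult_lt_0_compat; [now apply sqrt_lt_R0, HN | apply exp_pos]. }
    assert (Dh : forall t, in_itv a b t -> is_derive h t (h t * lam t)).
    { intros t Ht; specialize (HN t Ht).
      destruct (C2_on_elim _ _ _ _ (Hc cx) Ht) as (x1 & x2 & _).
      destruct (C2_on_elim _ _ _ _ (Hc cy) Ht) as (y1 & y2 & _).
      exact (is_derive_conformal_speed _ _ X Y t _ _ x1 y1 x2 y2 HN). }
    assert (Ch : forall t, in_itv a b t -> continuous h t).
    { intros t Ht; apply (ex_derive_continuous h); exists (h t * lam t); auto. }
    assert (Clam : forall t, in_itv a b t -> continuous (fun t => h t * lam t) t).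
    { intros t Ht; specialize (HN t Ht).
      destruct (C2_on_elim _ _ _ _ (Hc cx) Ht) as (x1 & x2 & x3).
      destruct (C2_on_elim _ _ _ _ (Hc cy) Ht) as (y1 & y2 & y3).
      assert (C : forall (f : R -> R) (l : R), is_derive f t l -> continuous f t)
        by (intros f l Hl; apply (ex_derive_continuous f); now exists l).
      apply C in x1, x2, y1, y2.
      apply continuous_Rmult; [now apply Ch | unfold lam, Rdiv].
      assert (CN : continuous (fun s => / N s) t).
      { apply continuous_Rinv_comp; [unfold N; simpl | lra].
        repeat first [apply continuous_const | assumption
          | apply continuous_Rmult | apply continuous_Rplus]. }
      repeat first [assumption | apply continuous_Rmult | apply continuous_Rplus]. }
    (* Base point of the arc length integral; any point of the interval serves. *)
    destruct (in_itv_inhabited a b Hab) as [t0 Ht0].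
    destruct (C2_diffeo_inverse a b (RInt h t0) h (fun t => h t * lam t))
      as (a' & b' & phi & Hphi & Dphi); auto.
    { intros t Ht.
      apply is_derive_RInt with t0; [|now apply Ch].
      apply filter_imp with (2 := locally_in_itv _ _ _ Ht).
      intros r Hr; apply (RInt_correct h), (ex_RInt_continuous h).
      intros z Hz; apply Ch.
      destruct (Rle_dec t0 r).
      - rewrite Rmin_left, Rmax_right in Hz by lra.
        now apply in_itv_between with t0 r.
      - rewrite Rmin_right, Rmax_left in Hz by lra.
        now apply in_itv_between with r t0. }
    exists a', b', phi; split; [exact Hphi|].
    destruct Hphi as (Cphi & Hin & _).
    apply (geodesic_reparam_iff a b a' b'); auto.
    intros s Hs k; destruct (Dphi s Hs) as [-> ->].
    assert (Ht := Hin s Hs); set (t := phi s) in *.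
    specialize (hpos t Ht); specialize (HN t Ht); specialize (H t Ht).
    unfold curvature_rel, lam, N in *; clear lam N.
    replace (Derive_n (fun t => Defs.comp k (c t)) 2 t)
      with (match k with cx => A t | cy => B t end) by now destruct k.
    unfold velocity in *; fold X Y in H |- *.
    clearbody A B X Y h; clear -hpos HN H.
    destruct (c t) as [x y]; unfold dot; cbn [fst snd] in *.
    set (N := X t ^ 2 + Y t ^ 2) in *.
    (* After substituting [phi' = 1 / h] and [phi'' = - lam / h^2], the tangential part vanishes.
       What is left is a multiple of [(Y, -X)] whose coefficient contains the defect of
       [curvature_rel], which is zero by [H]. *)
    transitivity (/ h t ^ 2 / N * (match k with cx => Y t | cy => - X t end) *
      (N * (y * X t - x * Y t) - (X t * B t - Y t * A t))).
    - destruct k; cbn -[pow]; unfold N in *; field; lra.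
    - rewrite H; ring.
Qed.
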